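(* Let $0<q\le\infty$, $1\le p\le\infty$, and let $u,v,w$ be weights on $(0,\infty)$. Then the inequality $$\|Sh\|_{q,w,(0,\infty)}\le c\,\|h\|_{p,v,(0,\infty)}$$ holds for all $h\in\mathcal M^+(0,\infty)$ (with some finite constant $c$ independent of $h$) if and only if the inequality $$\left\|H_u\left(\int_t^\infty h(s)\,ds\right)\right\|_{q,w,(0,\infty)}\le c\,\|hU\|_{p,v,(0,\infty)}$$ holds for all $h\in\mathcal M^+(0,\infty)$ (with some finite constant $c$ independent of $h$).
   Context: A weight is a locally integrable non-negative function on $(0,\infty)$; $\mathcal M^+(0,\infty)$ is the set of non-negative measurable functions on $(0,\infty)$. $U(t)=\int_0^tu(s)\,ds$, and it is assumed that $U(t)>0$ for every $t>0$. $\|f\|_{p,w,(0,\infty)}=\left(\int_0^\infty|f(x)|^pw(x)\,dx\right)^{1/p}$ for $0<p<\infty$ and $\|f\|_{\infty,w,(0,\infty)}=\operatorname{ess\,sup}_{x\in(0,\infty)}|f(x)|w(x)$. The generalized Stieltjes transform is $(Sh)(x)=\int_0^\infty\frac{h(t)\,dt}{U(x)+U(t)}$. The weighted Hardy operator is $H_uf(x)=\frac1{U(x)}\int_0^xf(t)u(t)\,dt$; in the second inequality it is applied to the function $t\mapsto\int_t^\infty h(s)\,ds$. The letter $c$ denotes a constant that may differ between the two inequalities. Conventions: $1/0=\infty$, $1/\infty=0$, $0\cdot\infty=0$, $0/0=0$, $\infty/\infty=0$. *)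

(* Defs.v *)
From HB Require Import structures.
From mathcomp Require Import all_boot all_order all_algebra.
From mathcomp Require Import all_classical all_reals all_analysis.
From mathcomp Require Import measurable_realfun ess_sup_inf.

Set Implicit Arguments.
Unset Strict Implicit.
Unset Printing Implicit Defensive.

Import Order.TTheory GRing.Theory Num.Theory.
Import numFieldNormedType.Exports.

Local Open Scope classical_set_scope.
Local Open Scope ring_scope.
Local Open Scope ereal_scope.

(* Functions on (0, oo) are total functions on R whose values outside
   `]0, +oo[ are never used.  In \bar R one has 0 * +oo = 0, 0^-1 = +oo and
   +oo^-1 = 0, hence 0 / 0 = 0 and +oo / +oo = 0. *)

Section Defs.
Context {R : realType}.
Implicit Types (w u : R -> R) (f h : R -> \bar R).

Definition weight w : Prop :=
  locally_integrable `]0%R, +oo[ w /\ (forall x : R, (0 < x)%R -> (0 <= w x)%R).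

Definition nonneg_measurable h : Prop :=
  measurable_fun (`]0%R, +oo[ : set R) h /\ (forall x : R, (0 < x)%R -> 0 <= h x).

(* Possibly +oo: local integrability on (0, oo) says nothing near 0. *)
Definition primitive u (t : R) : \bar R :=
  \int[lebesgue_measure]_(s in `]0%R, t]) (u s)%:E.

(* For p = +oo, extending |f| w by 0 outside (0, oo) leaves the essential
   supremum over (0, oo) unchanged since |f| w >= 0 there.  The value at
   p = -oo is junk. *)
Definition wnorm (p : \bar R) w f : \bar R :=
  match p with
  | r%:E =>
      (\int[lebesgue_measure]_(x in `]0%R, +oo[) (`|f x| `^ r * (w x)%:E))
        `^ r^-1
  | +oo =>
      ess_sup lebesgue_measure
        ((fun x => `|f x| * (w x)%:E) \_ `]0%R, +oo[)
  | -oo => 0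
  end.

Definition stieltjes u h (x : R) : \bar R :=
  \int[lebesgue_measure]_(t in `]0%R, +oo[)
    (h t / (primitive u x + primitive u t)).

Definition hardy u f (x : R) : \bar R :=
  (primitive u x)^-1 * \int[lebesgue_measure]_(t in `]0%R, x]) (f t * (u t)%:E).

Definition tail_integral h (t : R) : \bar R :=
  \int[lebesgue_measure]_(s in `[t, +oo[) h s.

End Defs.

(* Main.v *)
Require Import Defs.
From HB Require Import structures.
From mathcomp Require Import all_boot all_order all_algebra.
From mathcomp Require Import all_classical all_reals all_analysis.
From mathcomp Require Import measurable_realfun ess_sup_inf.
From mathcomp Require Import lra.
Import Order.TTheory GRing.Theory Num.Theory.
Import numFieldNormedType.Exports.
Local Open Scope classical_set_scope.
Local Open Scope ring_scope.
Local Open Scope ereal_scope.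

(* Writing U for the primitive of u, Tonelli's theorem turns the Hardy operator
   applied to the tail of h into
     H_u(int_t^oo h)(x) = int_0^oo h(s) U(s) / max(U(x), U(s)) ds,
   and max(a, b) <= a + b <= 2 max(a, b) makes this comparable, within a factor
   2, to S(hU)(x).  The substitution h <-> hU then exchanges the two
   inequalities when U is finite.  Since u is locally integrable on (0, oo), U
   is otherwise identically +oo, and both transforms vanish. *)

Section integral_monotone.
Import HBNNSimple.

(* Unlike [ge0_le_integral], no measurability is required: the transforms
   are compared without establishing that they are measurable. *)
Lemma ge0_le_integral_nomeas (d : measure_display) (T : measurableType d) (R : realType)
    (m : {measure set T -> \bar R}) (D : set T) (f g : T -> \bar R) :
  (forall x, D x -> 0 <= f x) -> (forall x, D x -> f x <= g x) ->
  \int[m]_(x in D) f x <= \int[m]_(x in D) g x.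
Proof.
move=> f0 fg.
have g0 x : D x -> 0 <= g x by move=> Dx; exact: le_trans (f0 _ Dx) (fg _ Dx).
rewrite !ge0_integralE//; apply: ereal_sup_le => _ [k /= kf <-].
exists k => // x.
by apply: le_trans (kf x) _; apply: lee_restrict.
Qed.

End integral_monotone.

Section transforms.
Context {R : realType}.
Notation mu := (@lebesgue_measure R).
Implicit Types (f g h : R -> \bar R) (u w : R -> R).

(** * Monotonicity, vanishing and homogeneity of the weighted norms *)

Lemma lebesgue_measure_setT_gt0 : 0 < mu [set: R].
Proof. by rewrite -set_itvNyy lebesgue_measure_itv/= ltry. Qed.

Lemma le_wnorm p w f g : 0 < p -> (forall x : R, (0 < x)%R -> (0 <= w x)%R) ->
  (forall x : R, (0 < x)%R -> 0 <= f x <= g x) -> wnorm p w f <= wnorm p w g.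
Proof.
move=> p0 w0 fg.
have abs_fg x : (0 < x)%R -> `|f x| <= `|g x|.
  by move=> /fg/andP[f0 fgx]; rewrite !gee0_abs// (le_trans f0).
case: p p0 => [r|_|//] /=.
- rewrite lte_fin => r0.
  have pow0 k x : `]0%R, +oo[%classic x -> 0 <= `|k x| `^ r * (w x)%:E.
    by rewrite /= in_itv/= andbT => x0; rewrite mule_ge0 ?poweR_ge0 ?lee_fin ?w0.
  apply: gt0_ler_poweR; rewrite ?invr_ge0 ?(ltW r0)// ?in_itv/= ?leey ?andbT;
    try by apply: integral_ge0 => x; exact: pow0.
  apply: ge0_le_integral_nomeas => x /[dup] /pow0 //.
  move=> ?; rewrite /= in_itv/= andbT => x0.
  rewrite lee_wpmul2r ?lee_fin ?w0//.
  by apply: gt0_ler_poweR; rewrite ?(ltW r0)// ?in_itv/= ?leey ?abse_ge0 ?abs_fg.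
- apply: le_ess_sup; apply: nearW => x; apply: lee_restrict => y.
  by rewrite /= in_itv/= andbT => y0; rewrite lee_wpmul2r ?lee_fin ?w0// abs_fg.
Qed.

Lemma wnorm0 p w : 0 < p -> wnorm p w (cst 0) = 0.
Proof.
case: p => [r|_|//] /=.
- rewrite lte_fin => r0.
  rewrite integral0_eq ?poweR0r ?invr_neq0 ?gt_eqF// => x _.
  by rewrite normr0 powR0 ?mul0e ?gt_eqF.
- rewrite [X in ess_sup _ X](_ : _ = cst 0); last first.
    by apply/funext => x; rewrite patchE; case: ifP => //; rewrite normr0 mul0e.
  (* The line has positive measure, so a constant is its own essential supremum. *)
  by rewrite ess_sup_cst // lebesgue_measure_setT_gt0.
Qed.

Lemma eq_wnorm p w f g : (forall x : R, (0 < x)%R -> f x = g x) ->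
  wnorm p w f = wnorm p w g.
Proof.
move=> fg; case: p => [r||] //=.
- by congr poweR; apply: eq_integral => x; rewrite inE/= in_itv/= andbT => /fg ->.
- congr ess_sup; apply/funext => x; rewrite !patchE; case: ifP => //.
  by rewrite inE/= in_itv/= andbT => /fg ->.
Qed.

Lemma weight_measurable w : weight w -> measurable_fun (`]0%R, +oo[ : set R) (EFin \o w).
Proof. by case=> -[mw _ _] _; exact/measurable_EFinP. Qed.

(** For a finite exponent [a], the factor leaves the integral as [r ^ a] and the outer power [1 / a]
    restores [r]. This serves to absorb the factor 2 of the kernel comparison into the constant. *)
Lemma wnormZ p w f (r : R) : 0 < p -> weight w -> nonneg_measurable f ->
  (0 < r)%R -> wnorm p w (fun x => r%:E * f x) = r%:E * wnorm p w f.
Proof.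
move=> p0 ww [mf f0] r0.
have [_ w0] := ww.
case: p p0 => [a|_|//] /=.
- rewrite lte_fin => a0.
  under eq_integral => x _.
    rewrite abseM poweRM// -muleA abse_EFin gtr0_norm// poweR_EFin.
    over.
  rewrite ge0_integralZl// ?lee_fin ?powR_ge0//.
  + rewrite poweRM ?lee_fin ?powR_ge0//.
      by rewrite poweR_EFin -powRrM mulfV ?gt_eqF// powRr1// ltW.
    apply: integral_ge0 => x /=; rewrite in_itv/= andbT => x0.
    by rewrite mule_ge0 ?poweR_ge0 ?lee_fin ?w0.
  + apply: emeasurable_funM; last exact: weight_measurable.
    apply: (@measurableT_comp _ _ _ _ _ _ (fun x => x `^ a)); first exact: measurable_poweR.
    exact: measurableT_comp.
  + move=> x /=; rewrite in_itv/= andbT => x0.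
    by rewrite mule_ge0 ?poweR_ge0 ?lee_fin ?w0.
- rewrite -ess_sup_pZl//; congr ess_sup; apply/funext => x /=.
  rewrite !patchE; case: ifP => _; last by rewrite mule0.
  by rewrite abseM abse_EFin gtr0_norm// muleA.
Qed.

(** * The primitive of a weight: sign, monotonicity, finiteness *)

Lemma primitive_ge0 u t : weight u -> 0 <= primitive u t.
Proof.
move=> [_ u0]; apply: integral_ge0 => x /=; rewrite in_itv/= => /andP[x0 _].
by rewrite lee_fin u0.
Qed.

Lemma weight_measurable_sub w (D : set R) : weight w -> D `<=` (`]0%R, +oo[ : set R) ->
  measurable_fun D (EFin \o w).
Proof. by move=> /weight_measurable mw DI; exact: measurable_funS mw. Qed.

Lemma primitive_mono u s t : weight u -> (s <= t)%R -> primitive u s <= primitive u t.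
Proof.
move=> wu st; apply: ge0_subset_integral => //.
- apply: weight_measurable_sub => // x /=; rewrite !in_itv/= andbT.
  by case/andP.
- move=> x /=; rewrite in_itv/= => /andP[x0 _].
  by rewrite lee_fin; apply: wu.2.
- by move=> x /=; rewrite !in_itv/= => /andP[-> /le_trans]; apply.
Qed.

(** Passing from [s] to a larger [t] adds at most the integral of [|u|] over the compact [[s, t]];
    as [s > 0], this set lies in (0, oo), where local integrability makes that integral finite. *)
Lemma primitive_lty u s t : weight u -> (0 < s)%R -> primitive u s < +oo ->
  primitive u t < +oo.
Proof.
move=> wu s0 us.
have [ts|st] := leP t s; first by apply: le_lt_trans us; exact: primitive_mono.
have u0 x : (0 < x)%R -> 0 <= (u x)%:E by move=> ?; rewrite lee_fin wu.2.
have uE : `]0%R, t]%classic = `]0%R, s] `|` `]s, t] :> set R.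
  by rewrite -itv_bndbnd_setU// bnd_simp ltW.
have mI (D : set R) : D `<=` (`]0%R, +oo[ : set R) -> measurable_fun D (EFin \o u).
  exact: weight_measurable_sub.
rewrite /primitive uE ge0_integral_setU//; last 3 first.
- by rewrite -uE; apply: mI => x /=; rewrite !in_itv/= andbT => /andP[].
- by move=> x; rewrite -uE/= in_itv/= => /andP[/u0].
- apply/disj_setPS => x [] /=; rewrite !in_itv/=.
  by move=> /andP[_ xs] /andP[/(le_lt_trans xs)]; rewrite ltxx.
rewrite lte_add_pinfty//.
have [[_ _ lu] _] := wu.
have stI : `[s, t]%classic `<=` (`]0%R, +oo[ : set R).
  by move=> x /=; rewrite !in_itv/= andbT => /andP[/(lt_le_trans s0)].
apply: le_lt_trans _ (lu _ stI (@segment_compact _ s t)).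
apply: le_trans (_ : \int[mu]_(x in `[s, t]) (u x)%:E <= _).
  apply: ge0_subset_integral => //; first exact: mI.
  - by move=> x /stI /=; rewrite in_itv/= andbT => /u0.
  - by move=> x /=; rewrite !in_itv/= => /andP[/ltW -> ->].
apply: ge0_le_integral_nomeas => x /stI /=; rewrite in_itv/= andbT => /u0 //.
by move=> _; rewrite lee_fin ler_norm.
Qed.

(** * Tonelli's theorem for the Hardy operator of a tail *)

Notation T := (measurableTypeR R).

(** The double integral runs over [0 < t <= x] and [t <= s]. For fixed [s > 0] the variable [t]
    fills []0, min x s]], whence the primitive at the minimum. *)
Lemma hardy_tail_kernel u h x : weight u -> nonneg_measurable h ->
  \int[mu]_(t in `]0%R, x]) (tail_integral h t * (u t)%:E) =
  \int[mu]_(s in `]0%R, +oo[) (h s * primitive u (Num.min x s)).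
Proof.
move=> wu [mh h0].
(* Both factors are extended by 0 to the whole line, and the constraint [t <= s] becomes the
   indicator of [A], so that Tonelli applies on the full plane. *)
pose H : T -> \bar R := h \_ `]0%R, +oo[.
pose V : T -> \bar R := (EFin \o u) \_ `]0%R, x].
have H0 s : 0 <= H s.
  by apply: erestrict_ge0 => y /=; rewrite in_itv/= andbT => /h0.
have V0 s : 0 <= V s.
  apply: erestrict_ge0 => y /=; rewrite in_itv/= => /andP[y0 _].
  by rewrite lee_fin wu.2.
have mH : measurable_fun setT H by exact/(measurable_restrictT _ _).1.
have mV : measurable_fun setT V.
  apply/(measurable_restrictT _ _).1 => //.
  apply: weight_measurable_sub => // y /=; rewrite !in_itv/= andbT.
  by case/andP.
pose A := [set z : T * T | (z.1 <= z.2)%R].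
have inA t s : ((t, s) \in A) = (t <= s)%R by apply/idP/idP; rewrite inE.
pose k (z : T * T) := H z.2 * (\1_A z)%:E.
have k0 z : 0 <= k z by rewrite /k mule_ge0// lee_fin.
have mk : measurable_fun setT k.
  apply: emeasurable_funM; first exact: measurableT_comp.
  apply/measurable_EFinP/measurable_indic.
  rewrite -[X in measurable X]setTI.
  exact: measurable_fun_le.
pose f (z : T * T) := V z.1 * k z.
have f0 z : 0 <= f z by rewrite /f mule_ge0.
have mf : measurable_fun setT f.
  by apply: emeasurable_funM => //; exact: measurableT_comp.
transitivity (\int[mu]_t \int[mu]_s f (t, s)).
  rewrite integral_mkcond; apply: eq_integral => t _.
  rewrite patchE; case: ifPn => [|tI]; last first.
    by rewrite integral0_eq// => s _; rewrite /f/= /V patchE (negbTE tI) mul0e.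
  rewrite inE/= => tI; rewrite /f/= ge0_integralZl//; last first.
    exact: (measurableT_comp mk (pair1_measurable t)).
  rewrite muleC /V patchE mem_set//=; congr (_ * _).
  rewrite /tail_integral integral_mkcond; apply: eq_integral => s _.
  rewrite /k /H !patchE indicE.
  move: tI; rewrite in_itv/= => /andP[t0 _].
  (* The default value [point] of a restriction is 0 here. Since [t > 0], the condition [t <= s]
     forces [s > 0], so cutting [h] off at 0 does not alter the tail. *)
  rewrite inA !mem_setE !in_itv/= !andbT -[point]/(0 : \bar R).
  by case: (leP t s) => ts /=; rewrite ?mule0// (lt_le_trans t0 ts) mule1.
rewrite fubini_tonelli// [RHS]integral_mkcond; apply: eq_integral => s _.
rewrite [in RHS]patchE; case: ifPn => [|sI]; last first.
  by rewrite integral0_eq// => t _; rewrite /f/= /k /H patchE (negbTE sI) mul0e mule0.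
rewrite inE/= => sI.
transitivity (\int[mu]_t (h s * ((EFin \o u) \_ `]0%R, Num.min x s]) t)).
  apply: eq_integral => t _.
  rewrite /f /k /H /V /= !patchE [s \in _]mem_set// muleCA; congr (_ * _).
  rewrite indicE inA !mem_setE !in_itv/= le_min -[point]/(0 : \bar R).
  case: (ltP 0%R t) => t0 /=; last by rewrite mul0e.
  case: (leP t x) => tx /=; last by rewrite mul0e.
  case: (leP t s) => ts /=; first by rewrite mule1.
  by rewrite mule0.
rewrite ge0_integralZl//.
- by rewrite /primitive [in RHS]integral_mkcond.
- apply/(measurable_restrictT _ _).1 => //.
  apply: weight_measurable_sub => // y /=; rewrite !in_itv/= andbT.
  by case/andP.
- move=> t _; apply: erestrict_ge0 => y /=; rewrite in_itv/= => /andP[y0 _].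
  by rewrite lee_fin wu.2.
- by move: sI; rewrite in_itv/= andbT => /h0.
Qed.

(** Here [a] stands for U(x) and [b] for U(s): [min(a, b) / a = b / max(a, b)], and
    [max(a, b) <= a + b <= 2 max(a, b)]. *)
Lemma min_ratio_bounds (a b : R) : (0 < a)%R -> (0 < b)%R ->
  (b / (a + b) <= a^-1 * Num.min a b <= 2 * (b / (a + b)))%R.
Proof.
move=> a0 b0; have ab0 : (0 < a + b)%R by rewrite addr_gt0.
rewrite [(a^-1 * _)%R]mulrC mulrA ler_pdivrMr// mulrAC ler_pdivlMr//.
rewrite ler_pdivrMr// mulrAC ler_pdivlMr//.
by case: (leP a b) => ab; nra.
Qed.

(** * Pointwise comparison of the two transforms for a finite primitive *)

Section finite_primitive.
Variable u : R -> R.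
Hypotheses (wu : weight u) (u_gt0 : forall t, (0 < t)%R -> 0 < primitive u t).
Hypothesis u_fin : forall t, primitive u t < +oo.
Let V t := fine (primitive u t).

Let UE t : primitive u t = (V t)%:E.
Proof. by rewrite /V fineK// ge0_fin_numE ?primitive_ge0. Qed.

Let V_gt0 t : (0 < t)%R -> (0 < V t)%R.
Proof. by move=> /u_gt0; rewrite UE lte_fin. Qed.

Let V_mono s t : (s <= t)%R -> (V s <= V t)%R.
Proof. by move=> st; rewrite -lee_fin -!UE primitive_mono. Qed.

Let V_min s t : V (Num.min s t) = Num.min (V s) (V t).
Proof. by case: (leP s t) => [/V_mono|/ltW/V_mono] st; [rewrite min_l|rewrite min_r]. Qed.

Let mV (D : set R) : measurable D -> measurable_fun D V.
Proof. by move=> mD; apply: nondecreasing_measurable. Qed.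

Let measurable_mulV h (k : R -> R) : nonneg_measurable h ->
  measurable_fun (`]0%R, +oo[ : set R) k -> (forall x, (0 < x)%R -> (0 <= k x)%R) ->
  nonneg_measurable (fun t => h t * (k t)%:E).
Proof.
move=> [mh h0] mk k0; split.
- by apply: emeasurable_funM => //; exact/measurable_EFinP.
- by move=> x x0; rewrite mule_ge0 ?lee_fin ?h0 ?k0.
Qed.

Lemma nonneg_measurable_mul_primitive h : nonneg_measurable h ->
  nonneg_measurable (fun t => h t * primitive u t).
Proof.
move=> mh; rewrite (_ : (fun _ => _) = fun t => h t * (V t)%:E); last first.
  by apply/funext => t; rewrite UE.
apply: measurable_mulV => //; first exact: mV.
by move=> x /V_gt0/ltW.
Qed.

(** Makes the substitution of [h U] for [h] surjective: on (0, oo) the primitive is positive and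
    finite, so division by it is legitimate. *)
Lemma nonneg_measurable_div_primitive h : nonneg_measurable h ->
  exists2 g, nonneg_measurable g &
    forall t, (0 < t)%R -> g t * primitive u t = h t.
Proof.
move=> mh; exists (fun t => h t * (V t)^-1%:E).
  apply: measurable_mulV => //.
  (* The inverse is read as the power -1, a measurable function; the two agree because [V t > 0]. *)
  - apply: (@eq_measurable_fun _ _ _ _ _ (fun t => V t `^ (-1))%R).
      move=> t; rewrite inE/= in_itv/= andbT => t0.
      by rewrite powR_inv1// ltW ?V_gt0.
    apply: (@measurableT_comp _ _ _ _ _ _ (fun x : R => x `^ (-1))%R).
      exact: measurable_powR.
    exact: mV.
  - by move=> x /V_gt0/ltW; rewrite invr_ge0.
by move=> t /V_gt0 Vt; rewrite UE -muleA -EFinM mulVf ?gt_eqF// mule1.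
Qed.

(** A nondecreasing [V] commutes with [min], and the factor [1 / V x] moves under the integral. *)
Lemma hardy_tailE h x : nonneg_measurable h -> (0 < x)%R ->
  hardy u (tail_integral h) x =
  \int[mu]_(s in `]0%R, +oo[) (h s * ((V x)^-1 * Num.min (V x) (V s))%:E).
Proof.
move=> mh x0; rewrite /hardy hardy_tail_kernel// UE inver gt_eqF ?V_gt0//.
rewrite -ge0_integralZl//.
- by apply: eq_integral => s _; rewrite UE V_min muleCA -EFinM.
- have [] // := @measurable_mulV h (fun s => V (Num.min x s)) mh.
  + apply: measurableT_comp; first exact: mV.
    exact: measurable_minr.
  + by move=> s s0; rewrite V_min le_min !ltW// V_gt0.
  + by move=> mhV _; apply: eq_measurable_fun mhV => t _; rewrite UE.
- move=> s /=; rewrite in_itv/= andbT => s0.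
  by rewrite mule_ge0 ?primitive_ge0// mh.2.
- by rewrite lee_fin invr_ge0 ltW ?V_gt0.
Qed.

Lemma stieltjes_mul_primitiveE h x : (0 < x)%R ->
  stieltjes u (fun t => h t * primitive u t) x =
  \int[mu]_(s in `]0%R, +oo[) (h s * (V s / (V x + V s))%:E).
Proof.
move=> x0; apply: eq_integral => s; rewrite inE/= in_itv/= andbT => s0.
rewrite !UE -EFinD inver gt_eqF ?addr_gt0 ?V_gt0//.
by rewrite -muleA -EFinM.
Qed.

Lemma stieltjes_le_hardy_tail h x : nonneg_measurable h -> (0 < x)%R ->
  stieltjes u (fun t => h t * primitive u t) x <= hardy u (tail_integral h) x.
Proof.
move=> mh x0; rewrite stieltjes_mul_primitiveE// hardy_tailE//.
apply: ge0_le_integral_nomeas => s /=; rewrite in_itv/= andbT => s0.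
  by rewrite mule_ge0 ?mh.2// lee_fin divr_ge0 ?addr_ge0// ltW ?V_gt0.
apply: lee_wpmul2l; first exact: mh.2.
by rewrite lee_fin; have /andP[] := min_ratio_bounds _ _ (V_gt0 _ x0) (V_gt0 _ s0).
Qed.

(** The factor 2 is kept inside the transform, so that later it has to be extracted only from the
    norm of the input, which is known to be measurable. *)
Lemma hardy_tail_le_stieltjes h x : nonneg_measurable h -> (0 < x)%R ->
  hardy u (tail_integral h) x <=
  stieltjes u (fun t => 2%:E * (h t * primitive u t)) x.
Proof.
(* Regrouped as [(2 h) U], the argument has the shape required by [stieltjes_mul_primitiveE]. *)
move=> mh x0; under [X in stieltjes _ X]eq_fun do rewrite muleA.
rewrite stieltjes_mul_primitiveE// hardy_tailE//.
apply: ge0_le_integral_nomeas => s /=; rewrite in_itv/= andbT => s0.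
  rewrite mule_ge0 ?mh.2// lee_fin mulr_ge0// ?invr_ge0 ?le_min ltW ?V_gt0//.
  by rewrite ltW ?V_gt0.
rewrite [2%:E * _]muleC -muleA -EFinM; apply: lee_wpmul2l; first exact: mh.2.
by rewrite lee_fin; have /andP[] := min_ratio_bounds _ _ (V_gt0 _ x0) (V_gt0 _ s0).
Qed.

End finite_primitive.

(** * The alternative on the primitive, and the equivalence *)

Lemma eq_stieltjes u f g : (forall x, (0 < x)%R -> f x = g x) ->
  stieltjes u f = stieltjes u g.
Proof.
move=> fg; apply/funext => x; apply: eq_integral => t.
by rewrite inE/= in_itv/= andbT => /fg ->.
Qed.

Lemma primitive_dichotomy u : weight u ->
  (forall t, primitive u t < +oo) \/ (forall t, (0 < t)%R -> primitive u t = +oo).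
Proof.
move=> wu; have [[s [s0 us]]|ninf] :=
    pselect (exists s, (0 < s)%R /\ primitive u s < +oo).
  by left=> t; exact: (primitive_lty _ _ _ wu s0 us).
right=> t t0; apply/eqP; rewrite -leye_eq leNgt; apply/negP => ut.
by apply: ninf; exists t.
Qed.

End transforms.

Theorem theorem5p5 (R : realType) (p q : \bar R) (u v w : R -> R)
    (hq : 0 < q) (hp : 1 <= p)
    (hu : weight u) (hv : weight v) (hw : weight w)
    (hU : forall t : R, (0 < t)%R -> 0 < primitive u t) :
  (exists2 c : R, (0 <= c)%R & forall h : R -> \bar R, nonneg_measurable h ->
     wnorm q w (stieltjes u h) <= c%:E * wnorm p v h)
  <->
  (exists2 c : R, (0 <= c)%R & forall h : R -> \bar R, nonneg_measurable h ->
     wnorm q w (hardy u (tail_integral h))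
       <= c%:E * wnorm p v (fun t => h t * primitive u t)).
Proof.
have p0 : 0 < p by exact: lt_le_trans hp.
have w0 := hw.2.
have [u_fin|u_inf] := primitive_dichotomy _ hu; last first.
  (* Infinite primitive: [1 / +oo = 0] kills both transforms on (0, oo), so the constant 0 serves in
     each inequality. *)
  have null f : (forall x, (0 < x)%R -> f x = 0) -> wnorm q w f = 0.
    by move=> f0; rewrite -(wnorm0 q w hq); exact: eq_wnorm.
  split=> _; exists 0%R => // h _; rewrite mul0e null// => x x0.
  - by rewrite /hardy u_inf// invey mul0e.
  - rewrite /stieltjes integral0_eq// => t /=; rewrite in_itv/= andbT => t0.
    by rewrite !u_inf// invey mule0.
split=> -[c c0 hc].
  (* The inequality for S is applied to [2 h U]; homogeneity of the norm turns its factor 2 into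
     part of the constant. *)
  exists (c * 2)%R => [|h mh]; first by rewrite mulr_ge0.
  have mhU := nonneg_measurable_mul_primitive _ hu hU u_fin _ mh.
  rewrite EFinM -muleA -wnormZ//.
  apply: le_trans (hc _ _); last first.
    split; first by apply: measurable_funeM; exact: mhU.1.
    by move=> x x0; rewrite mule_ge0 ?mhU.2.
  apply: le_wnorm => // x x0; rewrite hardy_tail_le_stieltjes// andbT.
  rewrite mule_ge0 ?inve_ge0 ?primitive_ge0//.
  apply: integral_ge0 => t /=; rewrite in_itv/= => /andP[t0 _].
  rewrite mule_ge0 ?lee_fin ?hu.2//; apply: integral_ge0 => s /=.
  by rewrite in_itv/= andbT => /(lt_le_trans t0); exact: mh.2.
exists c => // h mh.
(* With [h = g U] on (0, oo), [S h] is at most the Hardy transform of the tail of [g], so the same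
   [c] works. *)
have [g mg gU] := nonneg_measurable_div_primitive _ hu hU u_fin _ mh.
rewrite -(eq_stieltjes u _ _ gU) -(eq_wnorm p v _ _ gU).
apply: le_trans (hc _ mg); apply: le_wnorm => // x x0.
rewrite stieltjes_le_hardy_tail// andbT.
apply: integral_ge0 => t /=; rewrite in_itv/= andbT => t0.
have U0 y := primitive_ge0 u y hu.
by apply: mule_ge0; [rewrite mule_ge0 ?mg.2|rewrite inve_ge0 adde_ge0].
Qed.
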